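(* Let $\kappa$ be an infinite cardinal, let $X$ be a Tychonoff space and let $\mathcal{B}$ be a bornology with compact base on $X$. Then $C_{\mathcal{B}}(X)$ is productively $\kappa$-tight if, and only if, $l_{\mathcal{B}}(X_\kappa)\leq\kappa$.
   Context: A bornology $\mathcal{B}$ on a topological space $X$ is an ideal of subsets of $X$ (closed under subsets and finite unions) that covers $X$. A base for $\mathcal{B}$ is a subset $\mathcal{B}'\subset\mathcal{B}$ that is cofinal with respect to inclusion (every $B\in\mathcal{B}$ is contained in some $B'\in\mathcal{B}'$); the base is compact if all its elements are compact subsets of $X$. $C(X)$ is the set of continuous real-valued functions on $X$. For a bornology $\mathcal{B}$ with compact base, $C_{\mathcal{B}}(X)$ is $C(X)$ with the topology of uniform convergence on $\mathcal{B}$: a neighborhood base at $f\in C(X)$ is given by the sets $\langle B,\varepsilon\rangle[f]=\{g\in C(X):\forall x\in B\ (|f(x)-g(x)|<\varepsilon)\}$ for $B\in\mathcal{B}$, $\varepsilon>0$. For a topological space $Z$ and $z\in Z$, the tightness $t(z,Z)$ is the least cardinal $\kappa$ such that whenever $A\subset Z$ and $z\in\overline{A}$ there is $B\subset A$ with $|B|\leq\kappa$ and $z\in\overline{B}$; $t(Z)=\sup_{z\in Z}t(z,Z)$. $Z$ is productively $\kappa$-tight at $z\in Z$ if for every space $Y$ with $t(Y)\leq\kappa$ and every $y\in Y$ one has $t((z,y),Z\times Y)\leq\kappa$; $Z$ is productively $\kappa$-tight if it is productively $\kappa$-tight at each of its points. A family $\mathcal{C}$ of subsets of $X$ is a $\mathcal{B}$-covering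 for $X$ if for every $B\in\mathcal{B}$ there is $C\in\mathcal{C}$ with $B\subset C$; a $\mathcal{B}$-subcovering of $\mathcal{C}$ is a subfamily of $\mathcal{C}$ that is itself a $\mathcal{B}$-covering. A $G_\kappa$-set of $X$ is an intersection of at most $\kappa$ open subsets of $X$. $X_\kappa$ denotes the $\kappa$-modification of $X$ (the space obtained by declaring the $G_\kappa$-sets of $X$ open), and $l_{\mathcal{B}}(X_\kappa)$ denotes the least infinite cardinal $\lambda$ such that every $\mathcal{B}$-covering $\mathcal{U}$ for $X$ made by $G_\kappa$-sets of $X$ has a $\mathcal{B}$-subcovering $\mathcal{U}'\subset\mathcal{U}$ with $|\mathcal{U}'|\leq\lambda$. *)

(* Defs.v *)
From HB Require Import structures.
From mathcomp Require Import all_boot all_order all_algebra.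
From mathcomp Require Import all_classical all_reals all_analysis.

Set Implicit Arguments.
Unset Strict Implicit.
Unset Printing Implicit Defensive.

Import Order.TTheory GRing.Theory Num.Theory.
Import numFieldNormedType.Exports.
Local Open Scope classical_set_scope.
Local Open Scope card_scope.
Local Open Scope ring_scope.

(* Cardinals are represented by types and compared with [#<=]. A cardinal
   invariant is a predicate [c : Type -> Prop], where [c L] means that the
   value of the invariant is the cardinality of [L]. *)
Definition least_cardinal (P : Type -> Prop) (L : Type) : Prop :=
  P L /\ forall M : Type, P M -> [set: L] #<= [set: M].

Definition cardinal_le (c : Type -> Prop) (K : Type) : Prop :=
  exists2 L : Type, c L & [set: L] #<= [set: K].

Definition infinite_cardinal (K : Type) : Prop := infinite_set [set: K].

Definition tightness_at (Z : topologicalType) (z : Z) : Type -> Prop :=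
  least_cardinal (fun M : Type => forall A : set Z, closure A z ->
    exists B : set Z, [/\ B `<=` A, B #<= [set: M] & closure B z]).

(* the supremum is taken as the least upper bound *)
Definition tightness (Z : topologicalType) : Type -> Prop :=
  least_cardinal (fun M : Type => forall (z : Z) (N : Type),
    tightness_at z N -> [set: N] #<= [set: M]).

Definition productively_tight_at (K : Type) (Z : topologicalType) (z : Z) :=
  forall Y : topologicalType, cardinal_le (tightness Y) K ->
  forall y : Y, cardinal_le (@tightness_at (Z * Y)%type (z, y)) K.

Definition productively_tight (K : Type) (Z : topologicalType) : Prop :=
  forall z : Z, productively_tight_at K z.

Definition tychonoff_space (X : topologicalType) : Prop :=
  completely_regular_space X /\ hausdorff_space X.

Record bornology (X : Type) (B : set (set X)) : Prop := Bornology {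
  bornology0 : B set0 ;
  bornologyU : setU_closed B ;
  bornologyS : forall C D : set X, C `<=` D -> B D -> B C ;
  bornology_cover : \bigcup_(C in B) C = [set: X] }.

Definition bornology_base (X : Type) (B B' : set (set X)) : Prop :=
  B' `<=` B /\ forall C, B C -> exists2 C', B' C' & C `<=` C'.

Definition has_compact_base (X : topologicalType) (B : set (set X)) : Prop :=
  exists2 B', bornology_base B B' & B' `<=` compact.

Section FunctionSpace.
Variables (R : realType) (X : topologicalType) (B : set (set X)).

Definition cts_family (f : continuousType X R) : {family B, X -> R} := f.

(* the subspace topology that C(X) inherits from {family B, X -> R} *)
Definition CB : topologicalType := initial_topology cts_family.

Definition CB_ball (f : CB) (C : set X) (e : R) : set CB :=
  [set g : CB | forall x, C x -> `|cts_family f x - cts_family g x| < e].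

Lemma nbhs_CBP (f : CB) (V : set CB) : bornology B ->
  nbhs f V <-> exists C e, [/\ B C, 0 < e & CB_ball f C e `<=` V].
Proof.
move=> bB; split=> [|[C [e [BC e0 sV]]]]; last first.
  apply: filterS sV _.
  have entE : entourage [set uv : R * R | `|uv.1 - uv.2| < e].
    by rewrite -entourage_ballE; exists e => //= -[u v]; rewrite -ball_normE.
  exact: (@initial_continuous _ _ cts_family f _ (fam_nbhs _ entE BC)).
rewrite nbhsE => -[_ [[A oA <-] Af] sV].
pose ball (p : set X * R) : set {family B, X -> R} :=
  [set g | forall x, p.1 x -> `|cts_family f x - g x| < p.2].
pose D := [set p : set X * R | B p.1 /\ 0 < p.2].
pose F : set_system {family B, X -> R} := filter_from D ball.
have FF : Filter F.
  apply: filter_from_filter.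
    by exists (set0, 1); split=> //; exact: bornology0.
  move=> [C1 e1] [C2 e2] [/= B1 e10] [/= B2 e20].
  exists (C1 `|` C2, Num.min e1 e2) => [|g /= gP].
    by split=> /=; [exact: bornologyU | rewrite lt_min e10].
  by split=> x /= Cx; have := gP x; rewrite lt_min => gx;
    have /andP[] := gx ltac:(by [left|right]).
have /fam_cvgP : forall C, B C -> {uniform C, F --> cts_family f}.
  move=> C BC W /uniform_nbhs[E [entE sW]].
  move: entE; rewrite -entourage_ballE => -[e /= e0 sE].
  exists (C, e) => // g /= gP; apply: sW => x Cx.
  by apply: sE; rewrite /= -ball_normE; exact: gP.
move=> /(_ A); case.
  by apply: open_nbhs_nbhs; split.
move=> [C e] [/= BC e0] sA; exists C, e; split=> // g gP.
by apply: sV; apply: sA.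
Qed.

End FunctionSpace.

Section Coverings.
Variables (K : Type) (X : topologicalType) (B : set (set X)).

Definition bornology_covering (U : set (set X)) : Prop :=
  forall C, B C -> exists2 D, U D & C `<=` D.

Definition G_set (G : set X) : Prop :=
  exists F : set (set X),
    [/\ F #<= [set: K], F `<=` open & G = \bigcap_(O in F) O].

(* l_B(X_kappa), for kappa the cardinality of K *)
Definition bornology_lindelof : Type -> Prop :=
  least_cardinal (fun M : Type => infinite_cardinal M /\
    forall U : set (set X), bornology_covering U -> U `<=` G_set ->
    exists U' : set (set X),
      [/\ U' `<=` U, bornology_covering U' & U' #<= [set: M]]).

End Coverings.

(* Main.v *)
Require Import Defs.
From Stdlib Require List.
From HB Require Import structures.
From mathcomp Require Import all_boot all_order all_algebra.
From mathcomp Require Import all_classical all_reals all_analysis.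

Set Implicit Arguments.
Unset Strict Implicit.
Unset Printing Implicit Defensive.

Import Order.TTheory GRing.Theory Num.Theory.
Import numFieldNormedType.Exports.
Local Open Scope classical_set_scope.
Local Open Scope card_scope.
Local Open Scope ring_scope.

(* Sufficiency: let (f, y) be in the closure of A, with Y kappa-tight. For
   C in B and n, at most kappa elements (g, z) of A with |f - g| < 1/n on C
   have second coordinates accumulating at y. The conditions |f - g| < 1/n for
   these g define a G_kappa-set containing C, and for each n at most kappa of
   these G_kappa-sets form a B-covering; the corresponding pairs (g, z)
   accumulate at (f, y).

   Necessity: let U be a B-covering by G_kappa-sets. For C in the compact base
   choose U_C = \bigcap_k O_{C,k} in U containing C, and continuous functions
   g_{C,k} equal to 0 on C and to 1 outside O_{C,k}. For a finite list l in
   kappa put h_{C,l} = max(0, max_{k in l} g_{C,k}). Let Y consist of isolated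
   points (C, l) and a point oo, where V is a neighbourhood of oo when, for
   every C, it contains (C, l) for all sufficiently large l. Then Y is
   kappa-tight, because a set accumulates at oo only if its points (C, l) for
   one single C already
   do. The pairs (h_{C,l}, (C, l)) accumulate at (0, oo), and so does a subset
   of at most kappa of them. The sets U_C for the C occurring in that subset
   form a B-covering: if h_{C,l} < 1 on D for cofinally many l, then D is
   contained in U_C. *)

(** * Cardinal arithmetic *)

(* A maximal partial transversal [A] of the [F i], injective in each
   coordinate, must exhaust some [F i]; this [F i] is the least one. *)
Lemma least_card_family (I T : Type) (F : I -> set T) (i0 : I) :
  exists i, forall j, F i #<= F j.
Proof.
pose P (A : set (I -> T)) := forall i,
  [/\ forall t, A t -> F i (t i) &
      forall t u, A t -> A u -> t i = u i -> t = u].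
have [] := @Zorn_bigcup _ P.
  move=> C CP totC i; split=> [t [A CA At]|t u [A CA At] [A' CA' A'u]].
    by have [+ _] := CP _ CA i; apply.
  have [AA'|A'A] := totC _ _ CA CA'.
  - by have [_] := CP _ CA' i; apply => //; apply: AA'.
  - by have [_] := CP _ CA i; apply => //; apply: A'A.
move=> A [PA maxA].
have [[i Fi]|nF] := pselect (exists i, F i `<=` (fun t => t i) @` A).
  exists i => j; apply: card_le_trans (subset_card_le Fi) _.
  apply: card_le_trans (card_image_le _ _) _.
  have [FA Ainj] := PA j.
  have /card_eqPle[_ leA] : (fun t => t j) @` A #= A.
    by apply: inj_card_eq => t u /set_mem At /set_mem Au; apply: Ainj.
  apply: card_le_trans leA _; apply: subset_card_le => _ [t At <-].
  exact: FA.
have {nF} /choice[t tP] : forall i, exists x,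
    F i x /\ ~ ((fun t => t i) @` A) x.
  move=> i; apply: contrapT => nx; apply: nF; exists i => x Fx.
  by apply: contrapT => nAx; apply: nx; exists x.
have nAt : ~ A t by move=> At; have [_] := tP i0; apply; exists t.
exfalso; apply: (maxA (A `|` [set t])).
  split; last by move=> /(_ t (or_intror erefl)).
  by left.
move=> i; have [FA Ainj] := PA i; have [Ft tA] := tP i.
split=> [u [/FA//|->//]|u v [Au|->] [Av|->] //].
- exact: Ainj.
- by move=> uv; exfalso; apply: tA; exists u.
- by move=> tv; exfalso; apply: tA; exists v.
Qed.

Lemma card_le_total (T U : Type) (A : set T) (B : set U) : A #<= B \/ B #<= A.
Proof.
pose F (b : bool) : set (T + U) := if b then inl @` A else inr @` B.
have eqA : @inl T U @` A #= A by apply: inj_card_eq => x y _ _ [].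
have eqB : @inr T U @` B #= B by apply: inj_card_eq => x y _ _ [].
have [b /(_ (~~ b))] := least_card_family F true.
by case: b => /=; rewrite (card_le_eql eqA, card_le_eql eqB)
  (card_le_eqr eqA, card_le_eqr eqB); [left|right].
Qed.

Lemma card_leT_ex (T U : Type) : [set: T] #<= [set: U] ->
  exists f : T -> U, injective f.
Proof.
move=> /card_leP[f]; exists (fun x => val (f (to_setT x))) => x y.
by move=> /val_inj/(@inj _ _ _ f) xy; have [] := xy (in_setT _) (in_setT _).
Qed.

Lemma card_leT_inj (T U : Type) (f : T -> U) :
  injective f -> [set: T] #<= [set: U].
Proof.
move=> f_inj; have e : range f #= [set: T].
  by apply: inj_card_eq => x y _ _; apply: f_inj.
by rewrite -(card_le_eql e) card_leT.
Qed.

Lemma least_cardinal_ex (P : Type -> Prop) (K : Type) : P K ->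
  exists2 L, least_cardinal P L & [set: L] #<= [set: K].
Proof.
move=> PK.
(* Indexing by subsets of [K], not by types, keeps the index in the universe
   of [K]. *)
pose I := {A : set K | exists M, P M /\ [set: M] #= A}.
pose i0 : I := exist _ setT (ex_intro _ K (conj PK (card_eqxx _))).
have [i iP] := least_card_family (fun i : I => projT1 i) i0.
have [L [PL eL]] := projT2 i.
exists L; last by rewrite (card_le_eql eL); exact: card_leT.
split=> // M PM; rewrite (card_le_eql eL).
(* A type [M] that does not embed in [K] is at least as large as [K]; the index [i0], which stands
   for all of [K], then gives the bound. *)
have [/card_leT_ex[f finj]|KM] := card_le_total [set: M] [set: K]; last first.
  exact: card_le_trans (iP i0) KM.
have fM : [set: M] #= range f.
  by apply: card_esym; apply: inj_card_eq => x y _ _; apply: finj.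
rewrite (card_le_eqr fM).
exact: (iP (exist _ (range f) (ex_intro _ M (conj PM fM)))).
Qed.

Lemma card_le_range (T U : Type) (A : set T) (B : set U) (f : U -> T) :
  A `<=` f @` B -> A #<= B.
Proof.
by move=> Af; apply: card_le_trans (subset_card_le Af) (card_image_le _ _).
Qed.

Lemma card_le_rangeP (K T : Type) (t0 : T) (A : set T) :
  A #<= [set: K] <-> exists f : K -> T, A `<=` range f.
Proof.
split=> [|[f /card_le_range//]].
elim/Ppointed: T => T in t0 A *; first by case: (no t0).
by move=> /pcard_surjP[f fA]; exists f.
Qed.

Lemma card_le_ex (T U : Type) (u0 : U) (A : set T) (B : set U) : A #<= B ->
  exists2 f : T -> U, forall x, A x -> B (f x) &
    forall x y, A x -> A y -> f x = f y -> x = y.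
Proof.
elim/Ppointed: U => U in u0 B *; first by case: (no u0).
move=> /pcard_leP[f]; exists f => [x Ax|x y Ax Ay]; first exact: funS.
by apply: inj; exact: mem_set.
Qed.

(** * Squares of infinite sets *)

Section Squares.
Variable T : Type.

Let dom (G : set ((T * T) * T)) : set T := [set x | exists z, G ((x, x), z)].

(* [G] is the graph of an injection from [dom G * dom G] to [dom G]; unlike
   functions, graphs can be united along a chain. *)
Let squaring (G : set ((T * T) * T)) : Prop :=
  [/\ forall x y z, G ((x, y), z) -> [/\ dom G x, dom G y & dom G z],
      forall x y, dom G x -> dom G y -> exists z, G ((x, y), z),
      forall p z z', G (p, z) -> G (p, z') -> z = z' &
      forall p p' z, G (p, z) -> G (p', z) -> p = p'].

(** Any two elements of the union lie in a common member of the chain, and each clause involves at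
    most two elements of the graph. *)
Let squaring_bigcup (C : set (set ((T * T) * T))) : C `<=` squaring ->
  total_on C subset -> squaring (\bigcup_(G in C) G).
Proof.
move=> CS totC.
have domS G : C G -> dom G `<=` dom (\bigcup_(G in C) G).
  by move=> CG x [z Gz]; exists z, G.
have two p q : (\bigcup_(G in C) G) p -> (\bigcup_(G in C) G) q ->
    exists2 G, C G & G p /\ G q.
  move=> [G CG Gp] [H CH Hq]; have [GH|HG] := totC _ _ CG CH.
    by exists H => //; split=> //; apply: GH.
  by exists G => //; split=> //; apply: HG.
split.
- move=> x y z [G CG Gp]; have [+ _ _ _] := CS _ CG.
  by move=> /(_ _ _ _ Gp)[? ? ?]; split; apply: domS CG _ _.
- move=> x y [z Gx] [z' Gy]; have [G CG [Gx1 Gy1]] := two _ _ Gx Gy.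
  have [_ + _ _] := CS _ CG; case/(_ x y); [by exists z|by exists z'|].
  by move=> w Gw; exists w, G.
- move=> p z z' Gz Gz'; have [G CG [Gz1 Gz2]] := two _ _ Gz Gz'.
  by have [_ _ + _] := CS _ CG; apply; [exact: Gz1|exact: Gz2].
- move=> p p' z Gz Gz'; have [G CG [Gz1 Gz2]] := two _ _ Gz Gz'.
  by have [_ _ _ +] := CS _ CG; apply; [exact: Gz1|exact: Gz2].
Qed.

(** Zorn's lemma is applied to the sets whose union with [G0] is squaring, so that the maximal graph
    contains [G0]. *)
Let squaring_maximal (G0 : set ((T * T) * T)) : squaring G0 ->
  exists M, [/\ squaring M, G0 `<=` M &
    forall G, M `<=` G -> squaring G -> G `<=` M].
Proof.
move=> sG0; have [] := @Zorn_bigcup _ [set G | squaring (G0 `|` G)].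
  move=> F FS totF /=; pose C := G0 |` [set G0 `|` G | G in F].
  have -> : G0 `|` \bigcup_(G in F) G = \bigcup_(G in C) G.
    apply/seteqP; split=> [p [G0p|[G FG Gp]]|p [_ [->|[G FG <-]] //]].
    - by exists G0 => //; left.
    - by exists (G0 `|` G); right => //; exists G.
    - by left.
    - by case=> [|Gp]; [left|right; exists G].
  apply: squaring_bigcup => [_ [->//|[G FG <-]]|]; first exact: FS.
  move=> _ _ [->|[G FG <-]] [->|[H FH <-]]; [by left|by left| |].
    by right=> p; left.
  by have [|] := totF _ _ FG FH => ?; [left|right]; apply: setUS.
move=> A [sA maxA]; exists (G0 `|` A); split=> // G MG sG.
have eG : G0 `|` G = G by apply/setUidPr => p G0p; apply: MG; left.
apply: contrapT => nGM; apply: (maxA G); last by rewrite /= eG.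
by split=> [p Ap|GA]; [apply: MG; right|apply: nGM => p /GA; right].
Qed.

(* Take a maximal injection f : S * S -> S with S infinite. If S is at least as
   large as its complement, then all of T injects into S; otherwise f extends to
   the union of S and a disjoint copy h(S), the new pairs being sent to h(S). *)
Lemma card_le_square : infinite_cardinal T -> [set: T * T] #<= [set: T].
Proof.
move=> /infiniteP/card_leT_ex[i iinj].
have /card_eqPle[/card_leT_ex[c cinj] _] := card_nat2.
(* Starting from a graph on the copy [range i] of the naturals forces the domain [S] of the maximal
   graph to be infinite. *)
pose G0 : set ((T * T) * T) :=
  [set ((i p.1, i p.2), i (c p)) | p in [set: nat * nat]].
have dG0 n : dom G0 (i n) by exists (i (c (n, n))), (n, n).
have [|M [[M1 M2 M3 M4] G0M maxM]] := @squaring_maximal G0.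
  split.
  - by move=> x y z [[m n] _ [<- <- <-]].
  - move=> _ _ [_ [[m _] _ [<- _ _]]] [_ [[n _] _ [<- _ _]]].
    by exists (i (c (m, n))), (m, n).
  - by move=> p z z' [[m n] _ [<- <-]] [[m' n'] _ [/iinj -> /iinj -> <-]].
  - move=> p p' z [[m n] _ [<- <-]] [[m' n'] _ [<-]].
    by move=> /iinj/cinj[-> ->].
set S := dom M in M1 M2.
have iS n : S (i n) by have [z Mz] := dG0 n; exists z; apply: G0M.
have /choice[f fM] : forall p, exists z, S p.1 -> S p.2 -> M (p, z).
  move=> [x y] /=; have [Sx|] := pselect (S x); last by exists x.
  have [Sy|] := pselect (S y); last by exists x.
  by have [z Mz] := M2 _ _ Sx Sy; exists z.
have fS x y : S x -> S y -> S (f (x, y)).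
  by move=> Sx Sy; have [] := M1 _ _ _ (fM (x, y) Sx Sy).
have finj x y x' y' : S x -> S y -> S x' -> S y' ->
    f (x, y) = f (x', y') -> x = x' /\ y = y'.
  move=> Sx Sy Sx' Sy' e; have := fM (x, y) Sx Sy; rewrite e => Mxy.
  by have [] := M4 _ _ _ Mxy (fM (x', y') Sx' Sy').
have i01 : i 0 <> i 1 by move=> /iinj.
(* If [D] embeds in [S], so does the union of [S] and [D]: the first coordinates [i 0] and [i 1]
   separate two copies of [S] inside [S]. *)
have ext (D : set T) (g : T -> T) : (forall x, D x -> S (g x)) ->
    (forall x y, D x -> D y -> g x = g y -> x = y) ->
    exists e, (forall x, (S `|` D) x -> S (e x)) /\
      (forall x y, (S `|` D) x -> (S `|` D) y -> e x = e y -> x = y).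
  move=> gS ginj.
  exists (fun x => if x \in S then f (i 0, x) else f (i 1, g x)).
  have SD x : (S `|` D) x -> x \notin S -> D x.
    by move=> [Sx|//]; rewrite notin_setE.
  split=> [x SDx|x y SDx SDy].
    by case: ifPn => [/set_mem|/(SD _ SDx)/gS] Sx; apply: fS.
  case: ifPn => [/set_mem Sx|/(SD _ SDx) Dx];
    case: ifPn => [/set_mem Sy|/(SD _ SDy) Dy] E.
  - by have [] := finj _ _ _ _ (iS 0) Sx (iS 0) Sy E.
  - by have [/i01] := finj _ _ _ _ (iS 0) Sx (iS 1) (gS _ Dy) E.
  - by have [/esym/i01] := finj _ _ _ _ (iS 1) (gS _ Dx) (iS 0) Sy E.
  - have [_] := finj _ _ _ _ (iS 1) (gS _ Dx) (iS 1) (gS _ Dy) E.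
    exact: ginj.
have [/(card_le_ex (i 0))[h hS hinj]|/(card_le_ex (i 0))[g gS ginj]] :=
  card_le_total S (~` S); last first.
  have [e [eS einj]] := ext _ _ gS ginj.
  have SC x : (S `|` ~` S) x by rewrite setUv.
  apply: (@card_leT_inj _ _ (fun p => f (e p.1, e p.2))) => -[x y] [x' y'] /=.
  case/(finj _ _ _ _ (eS _ (SC _)) (eS _ (SC _)) (eS _ (SC _)) (eS _ (SC _))).
  by move=> /einj -> // /einj ->.
pose D := h @` S.
have /choice[g gP] : forall x, exists y, D x -> S y /\ h y = x.
  move=> x; have [[y Sy yx]|] := pselect (D x); last by exists x.
  by exists y.
have [e [eS einj]] := ext D g (fun x Dx => (gP x Dx).1)
  (fun x y Dx Dy exy => ltac:(by rewrite -(gP x Dx).2 exy (gP y Dy).2)).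
pose U := S `|` D.
pose N : set ((T * T) * T) := [set q | [/\ U q.1.1, U q.1.2,
  ~ (S q.1.1 /\ S q.1.2) & q.2 = h (f (e q.1.1, e q.1.2))]].
have feS x y : U x -> U y -> S (f (e x, e y)) by move=> /eS ? /eS ?; apply: fS.
have dU x : U x -> dom (M `|` N) x.
  move=> Ux; have [[z Mz]|nSx] := pselect (S x); first by exists z; left.
  by exists (h (f (e x, e x))); right; split=> // -[].
have /maxM : squaring (M `|` N).
  have Ud x : dom (M `|` N) x -> U x.
    by move=> [z [/M1[Sx _ _]|[]//]]; left.
  split.
  - move=> x y z [/M1[Sx Sy Sz]|[/= Ux Uy _ ->]].
      by split; apply: dU; left.
    by split; apply: dU => //; right; exists (f (e x, e y)) => //; apply: feS.
  - move=> x y /Ud Ux /Ud Uy; have [[Sx Sy]|nS] := pselect (S x /\ S y).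
      by have [z Mz] := M2 _ _ Sx Sy; exists z; left.
    by exists (h (f (e x, e y))); right.
  - move=> [x y] z z' [Mz|[/= Ux Uy nS ->]] [Mz'|[/= Ux' Uy' nS' ->]] //.
    + exact: M3 Mz Mz'.
    + by have [Sx Sy _] := M1 _ _ _ Mz; case: nS'.
    + by have [Sx Sy _] := M1 _ _ _ Mz'; case: nS.
  - move=> [x y] [x' y'] z [Mz|[/= Ux Uy nS ->]] [Mz'|[/= Ux' Uy' nS' e']].
    + exact: M4 Mz Mz'.
    + have [_ _ Sz] := M1 _ _ _ Mz.
      by exfalso; apply: hS (feS _ _ Ux' Uy') _; rewrite -e'.
    + have [_ _ Sz] := M1 _ _ _ Mz'.
      by exfalso; apply: hS (feS _ _ Ux Uy) _.
    + have := hinj _ _ (feS _ _ Ux Uy) (feS _ _ Ux' Uy') e'.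
      case/(finj _ _ _ _ (eS _ Ux) (eS _ Uy) (eS _ Ux') (eS _ Uy')).
      by move=> /einj -> // /einj ->.
(* The point [h (i 0)] is in the domain of the extended graph but not in [S], against maximality. *)
have Dhi : U (h (i 0)) by right; exists (i 0).
move=> /(_ (fun p Mp => or_introl Mp)) NM.
have [z /NM Mz] := dU _ Dhi; have [Shi _ _] := M1 _ _ _ Mz.
by case: (hS _ (iS 0) Shi).
Qed.

End Squares.

Lemma card_le_bigcup (K I T : Type) (D : set I) (F : I -> set T) :
  infinite_cardinal K -> D #<= [set: K] ->
  (forall i, D i -> F i #<= [set: K]) -> \bigcup_(i in D) F i #<= [set: K].
Proof.
move=> /card_le_square KK DK FK.
have [->|/set0P[x0 [i0 _ _]]] := eqVneq (\bigcup_(i in D) F i) set0.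
  exact: card_ge0.
have [d Dd] := (card_le_rangeP _ i0 _).1 DK.
have /choice[c Fc] : forall i, exists c : K -> T, D i -> F i `<=` range c.
  move=> i; have [/FK/(card_le_rangeP _ x0)[c Fc]|nDi] := pselect (D i).
    by exists c.
  by exists (fun=> x0).
apply: card_le_trans KK.
apply: (@card_le_range _ _ _ _ (fun p => c (d p.1) p.2)) => x [i Di Fx].
have [k _ ki] := Dd _ Di; have [l _ lx] := Fc _ Di _ Fx.
by exists (k, l); rewrite //= ki.
Qed.

Lemma card_nat_le (K : Type) (A : set nat) :
  infinite_cardinal K -> A #<= [set: K].
Proof. by move=> /infiniteP; apply: card_le_trans; exact: card_leT. Qed.

Lemma card_le_seq (K : Type) :
  infinite_cardinal K -> [set: seq K] #<= [set: K].
Proof.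
move=> infK; have /card_leT_ex[p pinj] := card_le_square infK.
have /infinite_setN0[k0 _] := infK.
have -> : [set: seq K] = \bigcup_(n in [set: nat]) [set s | size s = n].
  by apply/seteqP; split=> s // _; exists (size s).
apply: card_le_bigcup => // [|n _]; first exact: card_nat_le.
(* Iterated pairing is injective on lists of one fixed length; [k0] encodes the empty list. *)
have : {in [set s : seq K | size s = n] &,
    injective (foldr (fun x y => p (x, y)) k0)}.
  move=> s t /set_mem/= <- /set_mem/=.
  elim: s t => [|x s IHs] [|y t] //= [/IHs st] /pinj[<-].
  by move=> /st <-.
by move=> /inj_card_eq/card_eqPle[_ /card_le_trans]; apply; exact: card_leT.
Qed.

(** * Tightness and covering numbers bounded by a cardinal *)

(** A property that holds for some cardinal has a least one, so if it passes upwards to [K],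
    bounding the least one by [K] amounts to the property at [K]. *)
Lemma cardinal_le_leastP (P : Type -> Prop) (K : Type) :
  (forall L : Type, [set: L] #<= [set: K] -> P L -> P K) ->
  cardinal_le (least_cardinal P) K <-> P K.
Proof.
move=> Pmono; split=> [[L [PL _] LK]|PK]; first exact: Pmono LK PL.
exact: least_cardinal_ex.
Qed.

Definition tight_le (K : Type) (Z : topologicalType) (z : Z) : Prop :=
  forall A : set Z, closure A z ->
  exists B : set Z, [/\ B `<=` A, B #<= [set: K] & closure B z].

Lemma tight_leS (L K : Type) (Z : topologicalType) (z : Z) :
  [set: L] #<= [set: K] -> tight_le L z -> tight_le K z.
Proof.
move=> LK tL A /tL[B [BA BL zB]]; exists B; split=> //.
exact: card_le_trans BL LK.
Qed.

Lemma tightness_at_leP (K : Type) (Z : topologicalType) (z : Z) :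
  cardinal_le (tightness_at z) K <-> tight_le K z.
Proof.
by apply: (@cardinal_le_leastP (fun M => tight_le M z)) => L; apply: tight_leS.
Qed.

Lemma tightness_leP (K : Type) (Z : topologicalType) :
  cardinal_le (@tightness Z) K <-> forall z : Z, tight_le K z.
Proof.
apply: iff_trans.
  apply: cardinal_le_leastP => L LK PL z N /PL NL; exact: card_le_trans NL LK.
split=> [PK z|tK z N [_ leN]]; last exact/leN/tK.
(* The cardinality of [Z] bounds the tightness at [z], so a least bound exists and the supremum
   applies to it. *)
have tZ : tight_le Z z by move=> A zA; exists A; split=> //; exact: card_leT.
have [N tN _] := @least_cardinal_ex (fun M => tight_le M z) (Z : Type) tZ.
exact: tight_leS (PK z N tN) tN.1.
Qed.

Lemma bornology_lindelof_leP (K : Type) (X : topologicalType)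
    (B : set (set X)) : infinite_cardinal K ->
  cardinal_le (bornology_lindelof K B) K <->
  forall U : set (set X), bornology_covering B U -> U `<=` @G_set K X ->
  exists U' : set (set X),
    [/\ U' `<=` U, bornology_covering B U' & U' #<= [set: K]].
Proof.
move=> infK; apply: iff_trans.
  apply: cardinal_le_leastP => L LK [_ PL]; split=> // U covU GU.
  have [V [VU covV VL]] := PL U covU GU.
  by exists V; split=> //; apply: card_le_trans VL LK.
by split=> [[]|].
Qed.

(** * Spaces with a single non-isolated point *)

Section FilterSpace.
Variables (I : Type) (F : set_system I) (FF : Filter F).

(** Carrying the filter proof in the type lets the topology instance recover it. [None] is the
    special point; every [Some i] is isolated. *)
Definition filter_space (_ : Filter F) : Type := option I.

Local Notation Y := (filter_space FF).

HB.instance Definition _ := gen_eqMixin Y.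
HB.instance Definition _ := gen_choiceMixin Y.

Let op (O : set Y) : Prop := O None -> F [set i | O (Some i)].

Let opT : op setT. Proof. by move=> _; apply: filterT. Qed.

Let opI : setI_closed op.
Proof. by move=> O P oO oP [/oO FO /oP FP]; apply: filterI. Qed.

Let op_bigU (J : Type) (f : J -> set Y) :
  (forall j, op (f j)) -> op (\bigcup_j f j).
Proof.
by move=> of_ [j _ /of_]; apply: filterS => i fji; exists j.
Qed.

HB.instance Definition _ := isOpenTopological.Build Y opT opI op_bigU.

Lemma filter_space_openP (O : set Y) :
  open O <-> (O None -> F [set i | O (Some i)]).
Proof. by []. Qed.

Lemma closure_filter_space_None (A : set Y) :
  closure A None <-> A None \/ ~ F [set i | ~ A (Some i)].
Proof.
split=> [clA|[AN|nF] W].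
- apply: contrapT => /not_orP[nAN /contrapT FA].
  have [] := clA (~` A); last by move=> y [].
  by apply: open_nbhs_nbhs; split.
- by move=> /nbhs_singleton WN; exists None.
- rewrite nbhsE => -[V [oV VN] VW]; apply: contrapT => nAW; apply: nF.
  move/filter_space_openP: oV => /(_ VN); apply: filterS => i Vi Ai.
  by apply: nAW; exists (Some i); split=> //; apply: VW.
Qed.

Lemma closure_filter_space_Some (A : set Y) (i : I) :
  closure A (Some i) -> A (Some i).
Proof.
move=> /(_ [set Some i])[]; last by move=> y [/[swap] ->].
by apply: open_nbhs_nbhs; split.
Qed.

End FilterSpace.

Section Tails.
Variable T : Type.

(** Lists are ordered by inclusion of their sets of entries, so this is the filter of tails of the
    directed set of finite subsets. *)
Definition list_tails : set_system (seq T) :=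
  filter_from setT (fun l => [set l' | forall a, List.In a l -> List.In a l']).

Global Instance list_tails_filter : ProperFilter list_tails.
Proof.
apply: filter_from_proper; last by move=> l _; exists l.
apply: filter_from_filter; first by exists nil.
move=> l1 l2 _ _; exists (l1 ++ l2) => // l ll.
by split=> a al; apply: ll; apply: List.in_or_app; [left|right].
Qed.

Lemma list_tails_in (a : T) : list_tails [set l | List.In a l].
Proof. by exists [:: a] => // l /(_ a); apply; left. Qed.

End Tails.

(** * Separation of compact and closed sets *)

Section ListMax.
Variables (R : realType) (I : Type) (X : topologicalType) (h : I -> X -> R).

Fixpoint list_max (l : seq I) (x : X) : R :=
  if l is i :: l' then Num.max (h i x) (list_max l' x) else 0.

Lemma le_list_max l x i : List.In i l -> h i x <= list_max l x.
Proof.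
elim: l => //= j l IHl [->|/IHl il]; first by rewrite le_max lexx.
by rewrite le_max il orbT.
Qed.

Lemma list_max_eq0 l x : (forall i, h i x = 0) -> list_max l x = 0.
Proof. by move=> h0; elim: l => //= i l ->; rewrite h0 maxxx. Qed.

Lemma list_max_continuous l :
  (forall i, continuous (h i)) -> continuous (list_max l).
Proof.
move=> ch; elim: l => [|i l IHl] x /=; first exact: cst_continuous.
exact: (@continuous_max _ _ _ _ x (ch i x) (IHl x)).
Qed.

End ListMax.

(* The finite sets of functions [h] with support in [O] form a filter base, so
   that compactness of [C], as a near-covering property, provides finitely many
   of them with maximum greater than 1/2 on [C]. *)
Lemma compact_separation (R : realType) (X : topologicalType) (C O : set X) :
  completely_regular_space X -> compact C -> open O -> C `<=` O ->
  exists f : X -> R, [/\ continuous f,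
    forall x, C x -> f x = 0 & forall x, ~ O x -> f x = 1].
Proof.
move=> crX /compact_near_coveringP cC oO CO.
pose I := {h : X -> R | continuous h /\ forall x, ~ O x -> h x = 0}.
pose M := list_max (fun i : I => projT1 i).
have MO l x : ~ O x -> M l x = 0.
  by move=> nOx; apply: list_max_eq0 => i; have [_] := projT2 i; apply.
have Mc l : continuous (M l).
  by apply: list_max_continuous => i; have [] := projT2 i.
have half1 : (1 / 2 < 1 :> R) by rewrite ltr_pdivrMr// mul1r ltr1n.
have [|l _ /(_ _ (fun _ => id)) CM] :=
    cC _ (@list_tails I) (fun l x => 1 / 2 < M l x) (list_tails_filter I).
  move=> x Cx.
  have /(@uniform_separatorP _ R)[f [fc _ f0 f1]] :
      uniform_separator [set x] (~` O).
    by apply: crX; [exact: open_closedC|apply; apply: CO].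
  have hc : continuous (fun y => 1 - f y).
    by move=> y; apply: continuousB; [exact: cst_continuous|exact: fc].
  have h0 y : ~ O y -> 1 - f y = 0.
    by move=> nOy; rewrite (f1 (f y)) ?subrr//; exists y.
  pose i : I := exist _ (fun y => 1 - f y) (conj hc h0).
  exists ([set y | 1 / 2 < 1 - f y], [set l | List.In i l]); last first.
    move=> [y l] [/= fy il]; apply: lt_le_trans fy _.
    exact: (le_list_max (fun i : I => projT1 i) y il).
  split=> /=; last exact: list_tails_in.
  apply: (hc x [set r | 1 / 2 < r]); apply: open_nbhs_nbhs.
  split; first exact: open_gt.
  by rewrite /= (f0 (f x)) ?subr0//; exists x.
(* Truncation sends [M l x > 1/2] on [C] to 0 and [M l x = 0] off [O] to 1. *)
exists (fun x => Num.max 0 (1 - 2 * M l x)); split.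
- move=> x; have cM : {for x, continuous (fun y => 1 - 2 * M l y)}.
    apply: continuousB; first exact: cst_continuous.
    by apply: continuousM; [exact: cst_continuous|exact: Mc].
  exact: (@continuous_max _ _ _ _ x (@cst_continuous _ _ (0:R^o) x) cM).
- move=> x /CM xM; apply/max_idPl; rewrite subr_le0.
  by rewrite mulrC -ler_pdivrMr// ltW.
- by move=> x /MO ->; rewrite mulr0 subr0; apply/max_idPr.
Qed.

(** Indices whose value lies outside [F] contribute the whole space, which also covers an empty
    [F]. *)
Lemma G_set_enum (K : Type) (X : topologicalType) (U : set X) : G_set K U ->
  exists e : K -> set X, (forall k, open (e k)) /\ U = \bigcap_k e k.
Proof.
move=> [F [/(card_le_rangeP _ setT)[f Ff] Fo ->]].
exists (fun k => if f k \in F then f k else setT); split=> [k|].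
  by case: ifPn => [/set_mem/Fo//|_]; exact: openT.
apply/seteqP; split=> [x Fx k _|x fx W FW].
  by case: ifPn => // /set_mem; apply: Fx.
by have [k _ fk] := Ff _ FW; have := fx k I; rewrite fk mem_set.
Qed.

(** * The two implications *)

Section Necessity.
Variables (R : realType) (K : Type) (X : topologicalType) (B B' : set (set X)).
Hypotheses (infK : infinite_cardinal K) (crX : completely_regular_space X).
Hypotheses (bB : bornology B) (bbB' : bornology_base B B').
Hypothesis cB' : B' `<=` compact.
Hypothesis ptCB : productively_tight K (CB R B).

(** The tail conditions for different [C] in [B'] are independent; pairs with [C] outside [B'] are
    unconstrained. *)
Let base_tails : set_system (set X * seq K) :=
  [set W | forall C, B' C -> list_tails [set l | W (C, l)]].

Let base_tails_filter : Filter base_tails.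
Proof.
split=> [C _|P Q FP FQ C B'C|P Q PQ FP C B'C]; first exact: filterT.
  exact: filterI (FP C B'C) (FQ C B'C).
by apply: filterS (FP C B'C) => l; apply: PQ.
Qed.

Let Y : topologicalType := filter_space base_tails_filter.

Let Y_tight (y : Y) : tight_le K y.
Proof.
case: y => [i|] A; last first.
  case/closure_filter_space_None => [AN|/existsNP[C /not_implyP[B'C nA]]].
    exists [set None]; split=> [_ ->//||].
      by apply: (@card_le_range _ _ _ [set: K] (fun=> None)) => _ ->;
         have [k _] := infinite_setN0 infK; exists k.
    by apply: subset_closure.
  exists ((fun l => Some (C, l)) @` [set l | A (Some (C, l))]); split.
  - by move=> _ [l Al <-].
  - apply: card_le_trans (card_image_le _ _) _.
    apply: card_le_trans (card_leT _) _; exact: card_le_seq.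
  - apply/closure_filter_space_None; right => /(_ C B'C) CA; apply: nA.
    by apply: filterS CA => l nAl Al; apply: nAl; exists l.
move=> clA; have Ai := closure_filter_space_Some clA.
exists [set Some i]; split=> [_ ->//||].
  by apply: (@card_le_range _ _ _ [set: K] (fun=> Some i)) => _ ->;
     have [k _] := infinite_setN0 infK; exists k.
by apply: subset_closure.
Qed.

Lemma productively_tight_covering (U : set (set X)) :
  bornology_covering B U -> U `<=` @G_set K X ->
  exists U' : set (set X),
    [/\ U' `<=` U, bornology_covering B U' & U' #<= [set: K]].
Proof.
move=> covU GU; have [B'B baseB'] := bbB'.
have /choice[u uP] : forall C, exists D, B' C -> U D /\ C `<=` D.
  move=> C; have [/B'B/covU[D UD CD]|nB] := pselect (B' C); last by exists set0.
  by exists D.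
have /choice[e eP] : forall C, exists e : K -> set X,
    B' C -> (forall k, open (e k)) /\ u C = \bigcap_k e k.
  move=> C; have [/uP[/GU/G_set_enum[e eP] _]|nB] := pselect (B' C).
    by exists e.
  by exists (fun=> set0).
(* Continuity is required also for [C] outside [B'], so that [h] below is defined on all pairs. *)
have /choice[g gP] : forall p : set X * K, exists g : X -> R,
    [/\ continuous g, forall x, p.1 x -> B' p.1 -> g x = 0 &
      forall x, B' p.1 -> ~ e p.1 p.2 x -> g x = 1].
  move=> [C k] /=; have [B'C|nB] := pselect (B' C); last first.
    by exists (fun=> 0); split=> //; move=> x; exact: cst_continuous.
  have [eo ue] := eP _ B'C; have [_ Cu] := uP _ B'C.
  have [|g [gc gC gO]] := compact_separation R crX (cB' B'C) (eo k).
    by move=> x /Cu; rewrite ue; apply.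
  by exists g; split=> // x ? ?; [apply: gC|apply: gO].
pose m C l := list_max (fun k => g (C, k)) l.
have mc C l : continuous (m C l).
  by apply: list_max_continuous => k; have [] := gP (C, k).
pose h (p : set X * seq K) : CB R B := mkcts (mc p.1 p.2).
pose z : CB R B := mkcts (fun x : X => @cst_continuous X R (0 : R) x).
pose A : set (CB R B * Y) := [set (h p, Some p) | p in [set p | B' p.1]].
have clA : closure A (z, None).
  move=> W [[P Q] /= [zP YQ] PQW].
  have [C [r [BC r0 CP]]] := (@nbhs_CBP R X B z P bB).1 zP.
  have [C' B'C' CC'] := baseB' _ BC.
  have [V [[oV VN] VQ]] : exists V : set Y, open_nbhs (None : Y) V /\ V `<=` Q.
    by move: YQ; rewrite nbhsE => -[V ? ?]; exists V.
  (* For every [l], [h (C', l)] vanishes on [C'] and hence on [C]; only [V] restricts [l], and tails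
     are nonempty. *)
  have /filter_ex[l Vl] := oV VN _ B'C'.
  exists (h (C', l), Some (C', l)); split; first by exists (C', l).
  apply: PQW; split; last exact: VQ.
  apply: CP => x Cx; rewrite /= sub0r normrN [X in `|X|](_ : _ = 0) ?normr0//.
  apply: list_max_eq0 => k; have [_ + _] := gP (C', k).
  by apply=> //; apply: CC'.
have /tightness_at_leP/(_ A clA)[A' [A'A A'K clA']] :=
  ptCB z ((tightness_leP K Y).2 Y_tight) (None : Y).
exists ((fun p => if p.2 is Some q then u q.1 else set0) @` A'); split.
- by move=> _ [q /A'A[p B'p <-] <-]; have [] := uP _ B'p.
- move=> C BC.
  (* The second alternative is incompatible with lying in the unit ball around 0 on [C], so a point
     of [A'] in the ball times [V] yields [C] inside [u p.1]. *)
  pose V : set Y := fun y => if y is Some p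
    then C `<=` u p.1 \/ exists2 x, C x & 1 <= m p.1 p.2 x else True.
  have oV : open V.
    move=> _ D B'D /=; have [Cu|] := pselect (C `<=` u D).
      by apply: filterS filterT => l _; left.
    move=> /existsNP[x /not_implyP[Cx nux]].
    have [k nex] : exists k, ~ e D k x.
      apply: contrapT => nk; apply: nux; have [_ ->] := eP _ B'D.
      by move=> k _; apply: contrapT => ?; apply: nk; exists k.
    apply: filterS (list_tails_in k) => l kl; right; exists x => //.
    have [_ _ /(_ x B'D nex) <-] := gP (D, k).
    exact: (le_list_max (fun k => g (D, k)) x kl).
  have [] := clA' (CB_ball z C 1 `*` V).
    exists (CB_ball z C 1, V) => //; split; last exact: open_nbhs_nbhs.
    by apply/(@nbhs_CBP R X B z _ bB); exists C, 1; split=> //; exact: ltr01.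
  move=> q [A'q [zq Vq]]; have [p B'p hq] := A'A _ A'q.
  rewrite -{q}hq in A'q zq Vq; case: Vq => /= [Cu|[x Cx hx]].
    by exists (u p.1) => //; exists (h p, Some p).
  have := zq x Cx; rewrite /= sub0r normrN => /(le_lt_trans (ler_norm _)).
  by rewrite ltNge hx.
- exact: card_le_trans (card_image_le _ _) A'K.
Qed.

End Necessity.

(** * From small subcoverings to productive tightness *)

Section Sufficiency.
Variables (R : realType) (K : Type) (X : topologicalType) (B : set (set X)).
Hypotheses (infK : infinite_cardinal K) (bB : bornology B).
Hypothesis covB : forall U : set (set X),
  bornology_covering B U -> U `<=` @G_set K X ->
  exists U' : set (set X),
    [/\ U' `<=` U, bornology_covering B U' & U' #<= [set: K]].

Lemma covering_productively_tight : productively_tight K (CB R B).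
Proof.
move=> f Y /tightness_leP tY y; apply/tightness_at_leP => A clA.
pose r n : R := n.+1%:R^-1.
have r0 n : 0 < r n by rewrite invr_gt0.
have /choice[E EP] : forall q : set X * nat, exists E : set (CB R B * Y),
    B q.1 -> [/\ E `<=` A, E #<= [set: K],
      forall p, E p -> CB_ball f q.1 (r q.2) p.1 &
      forall V, nbhs y V -> exists2 p, E p & V p.2].
  move=> [C n] /=; have [BC|nB] := pselect (B C); last by exists set0.
  pose A1 := A `&` [set p | CB_ball f C (r n) p.1].
  (* Tightness of [Y] is applied to the projection of [A1], and [s] lifts the resulting set back to
     [A1]. *)
  have [D [DA DK clD]] : exists D : set Y,
      [/\ D `<=` snd @` A1, D #<= [set: K] & closure D y].
    apply: tY => V yV.
    have [] := clA (CB_ball f C (r n) `*` V).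
      exists (CB_ball f C (r n), V) => //; split=> //.
      by apply/(@nbhs_CBP R X B f _ bB); exists C, (r n); split=> //; exact: r0.
    by move=> p [Ap [fp Vp]]; exists p.2; split=> //; exists p.
  have /choice[s sP] : forall w, exists p : CB R B * Y, D w -> A1 p /\ p.2 = w.
    move=> w; have [/DA[p A1p pw]|nD] := pselect (D w); last by exists (f, y).
    by exists p.
  exists (s @` D) => _; split.
  - by move=> _ [w /sP[[]] + _ _ <-].
  - exact: card_le_trans (card_image_le _ _) DK.
  - by move=> _ [w /sP[[_ +] _] <-].
  - move=> V /clD[w [Dw Vw]]; exists (s w); first by exists w.
    by have [_ ->] := sP _ Dw.
pose G C n := \bigcap_(p in E (C, n))
  [set x | `|cts_family B f x - cts_family B p.1 x| < r n].
have GP C n : B C -> G_set K (G C n) /\ C `<=` G C n.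
  move=> BC; have [_ EK fE _] := EP (C, n) BC; split; last first.
    by move=> x Cx p /fE; apply.
  exists [set [set x | `|cts_family B f x - cts_family B p.1 x| < r n]
    | p in E (C, n)]; split.
  - exact: card_le_trans (card_image_le _ _) EK.
  - move=> _ [p _ <-].
    have dc : continuous (fun x => `|cts_family B f x - cts_family B p.1 x|).
      move=> x; apply: cvg_norm; apply: cvgB; exact: cts_fun.
    rewrite (_ : mkset _ = (fun x => `|cts_family B f x - cts_family B p.1 x|)
      @^-1` [set t | t < r n]) //.
    by apply: open_comp; [move=> x _; exact: dc|exact: open_lt].
  - by rewrite /G bigcap_image.
have /choice[U UP] : forall n, exists U : set (set X),
    [/\ U `<=` [set G C n | C in B], bornology_covering B U & U #<= [set: K]].
  move=> n; apply: covB => [C BC|_ [C BC <-]]; last by have [] := GP C n BC.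
  by exists (G C n); [exists C|have [] := GP C n BC].
have /choice[c cP] : forall q : nat * set X, exists C,
    U q.1 q.2 -> B C /\ G C q.1 = q.2.
  move=> [n W] /=; have [UW|nU] := pselect (U n W); last by exists set0.
  by have [UG _ _] := UP n; have [C BC CW] := UG _ UW; exists C.
exists (\bigcup_(n in [set: nat]) \bigcup_(W in U n) E (c (n, W), n)); split.
- move=> p [n _ [W UW]]; have [Bc _] := cP (n, W) UW.
  by have [+ _ _ _] := EP (c (n, W), n) Bc; apply.
- apply: card_le_bigcup => // [|n _]; first exact: card_nat_le.
  apply: card_le_bigcup => // [|W UW]; first by have [] := UP n.
  by have [Bc _] := cP (n, W) UW; have [] := EP (c (n, W), n) Bc.
- move=> N [[P V] /= [fP yV] PVN].
  have [C [d [BC d0 CP]]] := (@nbhs_CBP R X B f P bB).1 fP.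
  have [n] := ltr_add_invr d0; rewrite add0r => rd.
  have [_ /(_ _ BC)[W UW CW] _] := UP n.
  have /= [Bc GW] := cP (n, W) UW.
  (* The pair [p] is chosen for [c (n, W)] rather than [C], but its estimate holds on all of [W],
     which contains [C]. *)
  have [_ _ _ /(_ _ yV)[p Ep Vp]] := EP (_, n) Bc.
  exists p; split; first by exists n => //; exists W.
  apply: PVN; split=> //; apply: CP => x /CW; rewrite -GW => /(_ p Ep) /= fx.
  exact: lt_trans fx rd.
Qed.

End Sufficiency.

Theorem theorem3p5 (R : realType) (K : Type) (X : topologicalType)
    (B : set (set X)) :
  infinite_cardinal K -> tychonoff_space X ->
  bornology B -> has_compact_base B ->
  productively_tight K (CB R B) <->
  cardinal_le (bornology_lindelof K B) K.
Proof.
move=> infK [crX _] bB [B' bbB' cB'].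
apply: iff_trans (iff_sym (bornology_lindelof_leP _ infK)); split.
  move=> ptCB U; exact: (productively_tight_covering infK crX bB bbB' cB' ptCB).
exact: covering_productively_tight.
Qed.
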